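(* For every integer $d\ge 2$, $p'_{d+1}\le p'_d$, where $p'_d=\inf\{p\in[0,1]:\mathrm{RFM}(d,p)\text{ is recurrent}\}$ is the critical drift of the recursive frog model on the rooted $d$-ary tree.
   Context: $\mathbb T_d$ is the rooted $d$-ary tree: the infinite tree in which every vertex has exactly $d$ children, with root $\varnothing$. The recursive frog model $\mathrm{RFM}(d,p)$, $p\in[0,1]$: put $\rho=p/(1-p)$ if $p<1/2$ and $\rho=1$ if $p\ge 1/2$. Initially there is one awake frog at the root and one sleeping frog at each non-root vertex of $\mathbb T_d$. At each discrete time step one frog is sampled uniformly from the set of awake (not removed) frogs and performs one step. The initially awake frog at the root moves to a uniformly sampled child at its first step. Any other awake frog that has so far not moved away from the root moves, independently of everything else, to the parent of its current vertex with probability $\rho$, and with probability $1-\rho$ moves away from the root. Moving away from the root always means moving to a uniformly sampled child vertex of the current vertex (possibly the vertex from which the frog just came). Once a frog has moved away from the root, at all of its later steps it continues to move away from the root to a uniformly sampled child. A frog that reaches the root (by moving to it) is removed. A frog that moves away from the root and lands on a site that has already been visited by an awake frog is removed. Whenever an awake frog lands on a site with a sleeping frog, that sleeping frog wakes up and begins its own independent motion according to these rules. Recurrence: $\mathrm{RFM}(d,p)$ is recurrent if the total number of visits (arrivals) of frogs at the root is infinite almost surely. *)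

(* Defs.v *)
From HB Require Import structures.
From mathcomp Require Import all_boot all_order all_algebra.
From mathcomp Require Import all_classical all_reals all_analysis.

Set Implicit Arguments.
Unset Strict Implicit.
Unset Printing Implicit Defensive.

Import Order.TTheory GRing.Theory Num.Theory.

Local Open Scope classical_set_scope.
Local Open Scope ring_scope.

(* A vertex of the rooted d-ary tree is the word of child labels on the path
   to it from the root, most recent label first: the root is [::], the children
   of v are j :: v for j : 'I_d, and the parent of v is behead v. *)
Definition site (d : nat) := seq 'I_d.

(* An awake frog: its current vertex, and a flag that is true when all its
   remaining steps are away from the root, either because it has already moved
   away from the root or because it is the initial frog. *)
Definition frog (d : nat) := (site d * bool)%type.

Definition initial_frog (d : nat) : frog d := ([::], true).

(* [visited] lists the vertices visited so far by an awake frog; the vertices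
   carrying a sleeping frog are exactly those not in this list. [arrivals]
   counts the arrivals of frogs at the root so far. *)
Record config (d : nat) := Config {
  awake : seq (frog d);
  visited : seq (site d);
  arrivals : nat }.

Definition config_tuple (d : nat) (c : config d) :=
  (awake c, visited c, arrivals c).

Definition tuple_config (d : nat) (t : seq (frog d) * seq (site d) * nat) :=
  Config t.1.1 t.1.2 t.2.

Lemma config_tupleK (d : nat) : cancel (@config_tuple d) (@tuple_config d).
Proof. by case. Qed.

HB.instance Definition _ (d : nat) :=
  Countable.copy (config d) (can_type (@config_tupleK d)).

Definition initial_config (d : nat) : config d :=
  Config [:: initial_frog d] [:: [::]] 0.

(* The default value [initial_frog d] is never used for i < size (awake c). *)
Definition awake_frog (d : nat) (c : config d) (i : nat) : frog d :=
  nth (initial_frog d) (awake c) i.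

Definition replace_frog (d : nat) (c : config d) (i : nat)
    (s : seq (frog d)) : seq (frog d) :=
  take i (awake c) ++ s ++ drop i.+1 (awake c).

Definition woken (d : nat) (c : config d) (v : site d) : seq (frog d) :=
  if v \in visited c then [::] else [:: (v, false)].

Definition visit (d : nat) (c : config d) (v : site d) : seq (site d) :=
  if v \in visited c then visited c else v :: visited c.

Definition move_up (d : nat) (c : config d) (i : nat) : config d :=
  let v := behead (awake_frog c i).1 in
  if v == [::] then
    Config (replace_frog c i [::]) (visited c) (arrivals c).+1
  else
    Config (replace_frog c i ((v, false) :: woken c v)) (visit c v)
           (arrivals c).

Definition move_down (d : nat) (c : config d) (i : nat) (j : 'I_d) : config d :=
  let v := j :: (awake_frog c i).1 in
  if v \in visited c then
    Config (replace_frog c i [::]) (visited c) (arrivals c)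
  else
    Config (replace_frog c i ((v, true) :: woken c v)) (visit c v)
           (arrivals c).

Definition up_prob (R : realType) (p : R) : R :=
  if p < 2^-1 then p / (1 - p) else 1.

Definition frog_up_prob (R : realType) (p : R) (d : nat) (x : frog d) : R :=
  if x.2 then 0 else up_prob p.

(* One-step transition probability from c to c'. A configuration without awake
   frogs is absorbing. *)
Definition step_prob (R : realType) (d : nat) (p : R) (c c' : config d) : R :=
  let n := size (awake c) in
  if n == 0%N then (c' == c)%:R
  else \sum_(i < n) n%:R^-1 *
         (let r := frog_up_prob p (awake_frog c i) in
          r * (c' == move_up c i)%:R +
          \sum_(j < d) (1 - r) / d%:R * (c' == move_down c i j)%:R).

(* X is a realization of RFM(d,p) on the probability space (T, P): a Markov
   chain on the countable set of configurations, started from initial_config,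
   with transition probabilities step_prob. *)
Definition is_RFM (R : realType) (d : nat) (p : R) (disp : measure_display)
    (T : measurableType disp) (P : probability T R)
    (X : nat -> T -> config d) : Prop :=
  [/\ forall n c, measurable [set w | X n w = c],
      P [set w | X 0 w = initial_config d] = 1%E &
      forall n (c : nat -> config d),
        P [set w | forall k, (k <= n.+1)%N -> X k w = c k] =
        (P [set w | forall k, (k <= n)%N -> X k w = c k] *
         (step_prob p (c n) (c n.+1))%:E)%E].

(* These requirements determine the law of X, so recurrence does not depend on
   the realization. *)
Definition recurrent (R : realType) (d : nat) (p : R) : Prop :=
  forall (disp : measure_display) (T : measurableType disp)
         (P : probability T R) (X : nat -> T -> config d),
    is_RFM p P X ->
    {ae P, forall w, forall m : nat, exists n : nat, (m <= arrivals (X n w))%N}.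

(* The infimum is taken in the extended reals, where the infimum of the empty
   set is +oo rather than a default value. *)
Definition critical_drift (R : realType) (d : nat) : \bar R :=
  ereal_inf [set p%:E | p in [set p : R | 0 <= p <= 1 /\ recurrent d p]].

(* Main.v *)
Require Import Defs.
From HB Require Import structures.
From mathcomp Require Import all_boot all_order all_algebra.
From mathcomp Require Import all_classical all_reals all_analysis.
From mathcomp Require Import lra ring zify.

(* Let a player choose which awake frog moves, and let [controlled m n c] be the
   best probability of m arrivals at the root within n moves. Moves of distinct
   frogs commute in law, so an extra forced move never hurts the player; as
   uniform sampling a.s. eventually moves any given frog, uniform sampling
   achieves asymptotically at least this optimum, and hence exactly the limit of
   the optima. It remains to compare the optima for d <= d'. The player on the
   d'-ary tree imitates the one on the d-ary tree inside an embedded copy of the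
   visited tree: at a vertex with k visited children a downward move activates a
   new child with probability 1 - k / d, which increases with d. When the d'-ary
   process activates a child and the d-ary one does not, the two frogs of this
   child are left unmoved, and are identified with those of the next child
   activated by the d-ary process. *)

Set Implicit Arguments.
Unset Strict Implicit.
Unset Printing Implicit Defensive.

Import Order.TTheory GRing.Theory Num.Theory.
Import numFieldNormedType.Exports.

Local Open Scope ring_scope.

(** * Order of moves *)

Section Abelian.
Context (R : realType) (p : R) (p01 : 0 <= p <= 1).

Lemma frog_up_prob01 d (x : frog d) : 0 <= frog_up_prob p x <= 1.
Proof.
rewrite /frog_up_prob /up_prob; case: x.2; first by rewrite lexx ler01.
case: ifP => [p2|_]; last by rewrite ler01 lexx.
have {}p2 : p < 1 - p by lra.
have q0 : 0 < 1 - p by lra.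
by rewrite divr_ge0 ?(ltW q0) ?ler_pdivrMr ?mul1r ?(ltW p2) //; case/andP: p01.
Qed.

Section Dynamics.
Context {d : nat}.
Implicit Types (c : config d) (x y : frog d) (F : config d -> R).

(** Configurations store lists, so two orders of the same moves give the same state only up to this
    relation. *)
Definition config_equiv c c' :=
  [/\ perm_eq (awake c) (awake c'), visited c =i visited c' &
      arrivals c = arrivals c'].

Definition add_frog x c := Config (x :: awake c) (visited c) (arrivals c).
Definition del_frog x c := Config (rem x (awake c)) (visited c) (arrivals c).

(* The effect of one move of a frog x already deleted from c: up for None, to
   the child j for Some j. No sleeping frog is woken by an upward move, since in
   a reachable configuration the ancestors of visited sites are visited. *)
Definition act (o : option 'I_d) x c : config d :=
  if o is Some j then
    let v := j :: x.1 in
    if v \in visited c then c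
    else Config ((v, true) :: (v, false) :: awake c) (v :: visited c) (arrivals c)
  else
    let v := behead x.1 in
    if v == [::] then Config (awake c) (visited c) (arrivals c).+1
    else add_frog (v, false) c.

Definition weight x (o : option 'I_d) : R :=
  if o is Some _ then (1 - frog_up_prob p x) / d%:R else frog_up_prob p x.

Definition mean_move x F c := \sum_o weight x o * F (act o x c).

Lemma big_option (f : option 'I_d -> R) : \sum_o f o = f None + \sum_j f (Some j).
Proof.
rewrite (bigD1 None) //=; congr (_ + _).
rewrite (reindex_omap Some id) /=; last by case.
by apply: eq_bigl => j; rewrite eqxx.
Qed.

Lemma mean_moveE x F c :
  mean_move x F c = frog_up_prob p x * F (act None x c) +
    (1 - frog_up_prob p x) * (d%:R^-1 * \sum_j F (act (Some j) x c)).
Proof. by rewrite /mean_move big_option mulrA mulr_sumr. Qed.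

Lemma weight_ge0 x o : 0 <= weight x o.
Proof.
have /andP[r0 r1] := frog_up_prob01 x.
by case: o => [j|] //=; rewrite divr_ge0 // ?subr_ge0 // ler0n.
Qed.

Lemma sum_weight x : (0 < d)%N -> \sum_o weight x o = 1.
Proof.
move=> d0; rewrite big_option /= sumr_const card_ord -[X in _ + X]mulr_natr.
by rewrite divfK ?pnatr_eq0 -?lt0n // addrC subrK.
Qed.

Lemma mean_move_ge x F c k : (0 < d)%N -> (forall o, k <= F (act o x c)) ->
  k <= mean_move x F c.
Proof.
move=> d0 Fk; rewrite -[k]mul1r -(sum_weight x d0) mulr_suml.
by apply: ler_sum => o _; rewrite ler_wpM2l ?weight_ge0.
Qed.

Lemma arrivals_act o x c : (arrivals c <= arrivals (act o x c))%N.
Proof. by case: o => [j|] /=; case: ifP. Qed.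

Lemma le_mean_move x F F' c c' :
  (forall o, F (act o x c) <= F' (act o x c')) ->
  mean_move x F c <= mean_move x F' c'.
Proof. by move=> FF'; apply: ler_sum => o _; rewrite ler_wpM2l ?weight_ge0. Qed.

Lemma mean_moveBr x F c k : (0 < d)%N ->
  mean_move x (fun c' => F c' - k) c = mean_move x F c - k.
Proof.
move=> d0; rewrite /mean_move -[X in _ - X]mul1r -(sum_weight x d0) mulr_suml.
by rewrite -sumrB; apply: eq_bigr => o _; rewrite mulrBr.
Qed.

Lemma config_equiv_sym c c' : config_equiv c c' -> config_equiv c' c.
Proof. by case=> a b e; split; [rewrite perm_sym|move=> v; rewrite b|]. Qed.

Lemma config_equiv_trans c2 c1 c3 :
  config_equiv c1 c2 -> config_equiv c2 c3 -> config_equiv c1 c3.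
Proof.
move=> [a b e] [a' b' e']; split; first exact: perm_trans a a'.
- by move=> v; rewrite b b'.
- by rewrite e e'.
Qed.

Lemma del_frog_equiv x c c' :
  config_equiv c c' -> config_equiv (del_frog x c) (del_frog x c').
Proof.
case=> a b e; split => //=; apply/permP => q; rewrite !count_rem.
by rewrite (permP a) (perm_mem a).
Qed.

Lemma add_frog_equiv x c c' :
  config_equiv c c' -> config_equiv (add_frog x c) (add_frog x c').
Proof. by case=> a b e; split => //=; rewrite perm_cons. Qed.

Lemma add_frogK x c : config_equiv (del_frog x (add_frog x c)) c.
Proof. by split => //=; rewrite eqxx. Qed.

Lemma del_frogK x c : x \in awake c -> config_equiv c (add_frog x (del_frog x c)).
Proof. by move=> xc; split => //=; exact: perm_to_rem. Qed.

Lemma add_frogC x y c :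
  config_equiv (add_frog x (add_frog y c)) (add_frog y (add_frog x c)).
Proof. by split => //=; apply/permP => a /=; lia. Qed.

Lemma del_add_frog x y c : x \in awake c ->
  config_equiv (del_frog x (add_frog y c)) (add_frog y (del_frog x c)).
Proof.
move=> xc; apply: config_equiv_trans (add_frogK x _).
apply: del_frog_equiv; apply: config_equiv_trans (add_frogC _ _ _).
exact/add_frog_equiv/del_frogK.
Qed.

Lemma act_equiv o x c c' :
  config_equiv c c' -> config_equiv (act o x c) (act o x c').
Proof.
case: c => a1 v1 k1; case: c' => a2 v2 k2 [/= a b ->].
case: o => [j|] /=; last by case: ifP => _; split; rewrite //= perm_cons.
rewrite b; case: ifP => _; split; rewrite //= ?perm_cons //.
by move=> w; rewrite !inE b.
Qed.

Lemma act_add_frog o x y c :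
  config_equiv (act o x (add_frog y c)) (add_frog y (act o x c)).
Proof.
case: o => [j|] /=; case: ifP => _; split => //=; apply/permP => a /=; lia.
Qed.

(** With prescribed outcomes, two frogs interact only by entering the same unvisited child. The
    later one is then removed, and the pair left at the child does not record which frog came
    first. *)
Lemma actC o o' x y c :
  config_equiv (act o x (act o' y c)) (act o' y (act o x c)).
Proof.
case: o => [j|]; case: o' => [k|] /=.
- case: (boolP (k :: y.1 \in visited c)) => ky;
    case: (boolP (j :: x.1 \in visited c)) => jx /=;
    rewrite ?inE ?(negPf ky) ?(negPf jx) ?orbF ?ky ?jx ?orbT //=.
  case: (eqVneq (j :: x.1) (k :: y.1)) => [->//|_]; split => //=.
    by apply/permP => a /=; lia.
  by move=> w; rewrite !inE orbCA.
- case: (behead y.1 == [::]) => /=; case: ifP => _; split => //=;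
    apply/permP => a /=; lia.
- case: (behead x.1 == [::]) => /=; case: ifP => _; split => //=;
    apply/permP => a /=; lia.
- case: (behead x.1 == [::]); case: (behead y.1 == [::]); split => //=;
    apply/permP => a /=; lia.
Qed.

(** * Optimal choice of the moving frog *)

Definition invariant_fun F := forall c c', config_equiv c c' -> F c = F c'.

Lemma mean_move_equiv F x c c' : invariant_fun F -> config_equiv c c' ->
  mean_move x F c = mean_move x F c'.
Proof.
by move=> iF cc'; apply: eq_bigr => o _; rewrite (iF _ _ (act_equiv _ _ cc')).
Qed.

Lemma mean_moveC F x y c : invariant_fun F ->
  mean_move x (mean_move y F) c = mean_move y (mean_move x F) c.
Proof.
move=> iF; rewrite /mean_move.
under eq_bigr do rewrite mulr_sumr.
under [RHS]eq_bigr do rewrite mulr_sumr.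
rewrite exchange_big; apply: eq_bigr => o _; apply: eq_bigr => o' _.
by rewrite mulrCA (iF _ _ (actC _ _ _ _ _)).
Qed.

(** The first argument of the maximum lets the player stop early, and gives the value when no frog
    is awake. *)
Fixpoint controlled (m n : nat) c : R :=
  if n is n'.+1 then
    Num.max (controlled m n' c)
      (\big[Num.max/0]_(x <- awake c) mean_move x (controlled m n') (del_frog x c))
  else (m <= arrivals c)%N%:R.

Lemma controlled_ge0 m n c : 0 <= controlled m n c.
Proof. by elim: n => [|n IHn] /=; rewrite ?ler0n ?le_max ?IHn. Qed.

Lemma controlled_ind m n c (b : R) :
  controlled m n c <= b ->
  (forall x, x \in awake c -> mean_move x (controlled m n) (del_frog x c) <= b) ->
  controlled m n.+1 c <= b.
Proof.
move=> nb xb /=; rewrite ge_max nb /= big_seq.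
have b0 := le_trans (controlled_ge0 _ _ _) nb.
by apply: (big_ind (fun v => v <= b)) => // u v ub vb; rewrite ge_max ub.
Qed.

Lemma controlledS m n c : controlled m n c <= controlled m n.+1 c.
Proof. by rewrite /= le_max lexx. Qed.

Lemma controlled_move m n x c : x \in awake c ->
  mean_move x (controlled m n) (del_frog x c) <= controlled m n.+1 c.
Proof.
move=> xc; rewrite /= le_max; apply/orP; right.
exact: (le_bigmax_seq _ _ xpredT
  (fun y => mean_move y (controlled m n) (del_frog y c)) xc isT).
Qed.

Lemma controlled_le1 m n c : (0 < d)%N -> controlled m n c <= 1.
Proof.
move=> d0; elim: n c => [|n IHn] c; first by rewrite /= lern1 leq_b1.
apply: controlled_ind => // x _.
rewrite -(sum_weight x d0); apply: ler_sum => o _.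
by rewrite ler_piMr ?weight_ge0.
Qed.

Lemma controlled_equiv m n : invariant_fun (controlled m n).
Proof.
elim: n => [|n IHn] c c' cc' /=; first by case: cc' => _ _ ->.
rewrite (IHn _ _ cc') (perm_big (awake c')) /=; last by case: cc'.
congr (Num.max _ _); apply: eq_bigr => x _.
exact/mean_move_equiv/del_frog_equiv.
Qed.

(** A free forced move of [y] does not hurt. If the player first moves [y], this move has been made
    already; if another frog [x], the induction hypothesis inserts the forced move after it, and
    [mean_moveC] brings it to the front. *)
Lemma controlled_add_frog m n y c : (0 < d)%N ->
  controlled m n (add_frog y c) <= mean_move y (controlled m n) c.
Proof.
move=> d0; elim: n c => [|n IHn] c.
  apply: mean_move_ge => //= o; rewrite ler_nat; case: (leqP m) => //= mc.
  by rewrite lt0b (leq_trans mc) ?arrivals_act.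
have le_nS : mean_move y (controlled m n) c <= mean_move y (controlled m n.+1) c.
  by apply: le_mean_move => o; exact: controlledS.
apply: controlled_ind; first exact: le_trans (IHn c) le_nS.
move=> x; have [->{x} _|xy] := eqVneq x y.
  by rewrite (mean_move_equiv _ (@controlled_equiv m n) (add_frogK _ _)).
rewrite inE (negPf xy) /= => xc.
have iG := @controlled_equiv m n.
rewrite (mean_move_equiv _ iG (del_add_frog _ xc)).
apply: (@le_trans _ _ (mean_move x (mean_move y (controlled m n)) (del_frog x c))).
  apply: ler_sum => o _; rewrite ler_wpM2l ?weight_ge0 //.
  by rewrite (iG _ _ (act_add_frog _ _ _ _)).
rewrite mean_moveC //; apply: ler_sum => o _; rewrite ler_wpM2l ?weight_ge0 //.
have e : config_equiv (act o y c) (add_frog x (act o y (del_frog x c))).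
  apply: config_equiv_trans (act_add_frog _ _ _ _).
  exact/act_equiv/del_frogK.
apply: (@le_trans _ _ (controlled m n.+1 (add_frog x (act o y (del_frog x c))))).
  rewrite -(mean_move_equiv _ iG (add_frogK x _)).
  by apply: controlled_move; exact: mem_head.
by rewrite (@controlled_equiv m n.+1 _ _ (config_equiv_sym e)).
Qed.

(** * Uniform sampling and its limit *)

Definition uniform_move F c : R :=
  if size (awake c) == 0%N then F c
  else (size (awake c))%:R^-1 *
       \sum_(x <- awake c) mean_move x F (del_frog x c).

(** For valid [c], the probability that the model started at [c] has counted [m] arrivals by time
    [n]; see [iter_step_mean_sampled] and [RFM_arrivals]. *)
Definition sampled m n : config d -> R :=
  iter n uniform_move (fun c => (m <= arrivals c)%N%:R).

Lemma uniform_move_equiv F : invariant_fun F -> invariant_fun (uniform_move F).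
Proof.
move=> iF c c' cc'; have [a _ _] := cc'.
rewrite /uniform_move (perm_size a); case: ifP => _; first exact: iF.
rewrite (perm_big _ a) /=; congr (_ * _); apply: eq_bigr => x _.
exact/mean_move_equiv/del_frog_equiv.
Qed.

Lemma sampled_equiv m n : invariant_fun (sampled m n).
Proof.
elim: n => [|n IHn]; last exact: uniform_move_equiv.
by move=> c c' [_ _ e]; rewrite /sampled /= e.
Qed.

Lemma ler_uniform_move F F' c : (forall c', F c' <= F' c') ->
  uniform_move F c <= uniform_move F' c.
Proof.
move=> FF'; rewrite /uniform_move; case: ifP => // _.
rewrite ler_wpM2l ?invr_ge0 ?ler0n //; apply: ler_sum => x _.
by apply: le_mean_move => o.
Qed.

Lemma uniform_move_le F c k :
  (size (awake c) = 0%N -> F c <= k) ->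
  (forall x, x \in awake c -> mean_move x F (del_frog x c) <= k) ->
  uniform_move F c <= k.
Proof.
move=> Fk xk; rewrite /uniform_move; case: eqP => [//|/eqP n0].
rewrite mulrC ler_pdivrMr ?ltr0n ?lt0n //.
(* The multiple of [k] becomes a sum of [k] over the awake frogs, compared term by term. *)
rewrite mulr_natr -iter_addr_0 -count_predT -big_const_seq.
rewrite [leLHS]big_seq [leRHS]big_seq.
exact: ler_sum.
Qed.

Lemma sampledS m n c : sampled m n.+1 c = uniform_move (sampled m n) c.
Proof. by []. Qed.

Lemma sampled_ge0 m n c : 0 <= sampled m n c.
Proof.
elim: n c => [|n IHn] c; first exact: ler0n.
rewrite sampledS /uniform_move; case: ifP => // _.
rewrite mulr_ge0 ?invr_ge0 ?ler0n // sumr_ge0 // => x _.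
by rewrite sumr_ge0 // => o _; rewrite mulr_ge0 ?weight_ge0.
Qed.

Lemma sampled_le_controlled m n c : (0 < d)%N -> sampled m n c <= controlled m n c.
Proof.
move=> d0; elim: n c => [//|n IHn] c; rewrite sampledS.
apply: uniform_move_le => [_|x xc].
  exact: le_trans (controlledS _ _ _).
apply: le_trans (controlled_move _ _ xc); exact: le_mean_move.
Qed.

Lemma sampled_le1 m n c : (0 < d)%N -> sampled m n c <= 1.
Proof.
move=> d0.
exact: le_trans (sampled_le_controlled _ _ _ d0) (controlled_le1 _ _ _ d0).
Qed.

Lemma uniform_move_ge F c k :
  (size (awake c) = 0%N -> k <= F c) ->
  (forall x, x \in awake c -> k <= mean_move x F (del_frog x c)) ->
  k <= uniform_move F c.
Proof.
move=> Fk xk; rewrite /uniform_move; case: eqP => [//|/eqP n0].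
rewrite mulrC ler_pdivlMr ?ltr0n ?lt0n //.
rewrite mulr_natr -iter_addr_0 -count_predT -big_const_seq.
rewrite [leLHS]big_seq [leRHS]big_seq.
exact: ler_sum.
Qed.

Lemma sampled_homo m c : (0 < d)%N ->
  {homo (sampled m)^~ c : i j / (i <= j)%N >-> i <= j}.
Proof.
move=> d0; apply/nondecreasing_seqP => n; elim: n c => [|n IHn] c; last first.
  by rewrite sampledS [leRHS]sampledS; exact: ler_uniform_move.
apply: uniform_move_ge => // x _.
apply: mean_move_ge => // o; rewrite /sampled /= ler_nat; case: (leqP m) => //= mc.
by rewrite lt0b (leq_trans mc) // (arrivals_act o x (del_frog x c)).
Qed.

Definition arrivals_prob m c : R := limn ((sampled m)^~ c).

Lemma sampled_is_cvg m c : (0 < d)%N -> cvgn ((sampled m)^~ c).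
Proof.
move=> d0; apply: nondecreasing_is_cvgn; first exact: sampled_homo.
by exists 1 => _ [n _ <-]; exact: sampled_le1.
Qed.

Lemma sampled_le_arrivals_prob m n c : (0 < d)%N ->
  sampled m n c <= arrivals_prob m c.
Proof.
move=> d0; apply: nondecreasing_cvgn_le; first exact: sampled_homo.
exact: sampled_is_cvg.
Qed.

Lemma arrivals_probE m c : (0 < d)%N ->
  arrivals_prob m c = uniform_move (arrivals_prob m) c.
Proof.
move=> d0; apply/cvg_lim => //.
have cv c' : (sampled m n c' @[n --> \oo] --> arrivals_prob m c')%classic.
  exact: sampled_is_cvg.
rewrite -cvg_shiftS /=.
rewrite /uniform_move; case: ifP => _; first exact: cv.
apply: cvgMr; apply: cvg_big => [|x _]; first exact: add_continuous.
apply: cvg_big => [|o _]; first exact: add_continuous.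
by apply: cvgMr; exact: cv.
Qed.

(** A free move of [y] after that of [x] does not hurt, by [controlled_add_frog], and the two moves
    commute. So the chosen move of [x] can wait for a sampled move of another frog. *)
Lemma controlled_move_postpone m n x y c : (0 < d)%N ->
  x \in awake c -> y \in awake (del_frog x c) ->
  mean_move x (controlled m n) (del_frog x c) <=
  mean_move y (fun c' => mean_move x (controlled m n) (del_frog x c'))
    (del_frog y c).
Proof.
move=> d0 xc yc; set c1 := del_frog y (del_frog x c).
have iG := @controlled_equiv m n.
have c1y : config_equiv (del_frog x c) (add_frog y c1) by exact: del_frogK.
have c1x : config_equiv (del_frog y c) (add_frog x c1).
  apply: config_equiv_trans (add_frogK y _); apply: del_frog_equiv.
  apply: config_equiv_trans (del_frogK xc) _.
  exact: config_equiv_trans (add_frog_equiv _ c1y) (add_frogC _ _ _).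
rewrite (mean_move_equiv _ iG c1y).
apply: (@le_trans _ _ (mean_move x (mean_move y (controlled m n)) c1)).
  apply: ler_sum => o _; rewrite ler_wpM2l ?weight_ge0 //.
  by rewrite (iG _ _ (act_add_frog _ _ _ _)) controlled_add_frog.
rewrite mean_moveC // /mean_move le_eqVlt; apply/orP; left; apply/eqP.
apply: eq_bigr => o _; congr (_ * _).
apply: mean_move_equiv => //; apply: config_equiv_sym.
apply: config_equiv_trans (add_frogK x _); apply: del_frog_equiv.
exact: config_equiv_trans (act_equiv _ _ c1x) (act_add_frog _ _ _ _).
Qed.

Lemma mem_act o x c : {subset awake c <= awake (act o x c)}.
Proof.
by move=> y yc; case: o => [j|] /=; case: ifP => //=; rewrite !inE yc ?orbT.
Qed.

Lemma size_act o x c : (size (awake (act o x c)) <= (size (awake c)).+2)%N.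
Proof. by case: o => [j|] /=; case: ifP => //= _; lia. Qed.

(* The frog x is still unsampled after k uniformly sampled moves with
   probability at most N / (N + k), where N is the number of awake frogs,
   because this number grows by at most one at each move. *)
Lemma mean_move_le_arrivals_prob m n k x c : (0 < d)%N ->
  (forall c', controlled m n c' <= arrivals_prob m c') -> x \in awake c ->
  mean_move x (controlled m n) (del_frog x c) -
    (size (awake c))%:R / (size (awake c) + k)%:R <= arrivals_prob m c.
Proof.
move=> d0 Gh; elim: k x c => [|k IHk] x c xc.
  (* For [k = 0] the subtracted term is 1, which bounds the mean of [controlled]. *)
  have N0 : (size (awake c))%:R != 0 :> R.
    by rewrite pnatr_eq0; case: (awake c) xc.
  rewrite addn0 divff // lerBlDr -[leLHS]add0r lerD //.
    exact: le_trans (sampled_ge0 m 0 c) (sampled_le_arrivals_prob _ _ _ d0).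
  rewrite -(sum_weight x d0); apply: ler_sum => o _.
  by rewrite ler_piMr ?weight_ge0 ?controlled_le1.
set q := (size (awake c))%:R; set g := mean_move _ _ _.
have q0 : 0 < q by rewrite ltr0n; case: (awake c) xc.
have k0 : 0 <= k%:R :> R by exact: ler0n.
rewrite arrivals_probE // /uniform_move; case: eqP => [e|_].
  by move: xc; rewrite (size0nil e).
rewrite [leRHS]mulrC ler_pdivlMr // (big_rem x) //=.
(* The error left after a sampled move of another frog: at most [q + 1] frogs are then awake, and N
   / (N + k) increases with N. *)
pose q' := (q + 1) / (q + 1 + k%:R).
(* With the factor 1 / [q] cleared, sampling [x] contributes [g], and each of the [q - 1] other
   frogs at least [g - q']. *)
apply: (@le_trans _ _ (g + \sum_(y <- rem x (awake c)) (g - q'))); last first.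
  apply: lerD; first exact: le_mean_move.
  rewrite [leLHS]big_seq [leRHS]big_seq; apply: ler_sum => y yc.
  apply: (@le_trans _ _ (mean_move y
    (fun c' => mean_move x (controlled m n) (del_frog x c') - q')
    (del_frog y c))).
    by rewrite mean_moveBr // lerD2r controlled_move_postpone.
  apply: le_mean_move => o.
  set c' := act _ _ _.
  have xc' : x \in awake c'.
    (* Distinct frogs can be equal as values; [yc] then says that a second copy is left. *)
    apply: mem_act; have [xy|xy] := eqVneq x y.
      by move: yc; rewrite xy.
    exact: rem_mem.
  apply: le_trans (IHk _ _ xc'); rewrite lerD2l lerN2.
  have c'c : (size (awake c'))%:R <= q + 1.
    rewrite natr1 ler_nat (leq_trans (size_act _ _ _)) //= size_rem ?(mem_rem yc) //.
    by case: (awake c) xc.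
  have c'0 : 0 < (size (awake c'))%:R :> R by rewrite ltr0n; case: (awake c') xc'.
  rewrite /q' natrD ler_pdivrMr; last lra.
  rewrite mulrAC ler_pdivlMr; last lra.
  nra.
have -> : \sum_(y <- rem x (awake c)) (g - q') = (g - q') * (q - 1).
  rewrite big_const_seq count_predT iter_addr_0 size_rem //.
  by rewrite -[LHS]mulr_natr -subn1 natrB //; case: (awake c) xc.
have Dq : (size (awake c) + k.+1)%:R = q + 1 + k%:R by rewrite natrD -natr1; lra.
have D0 : 0 < (q + 1 + k%:R)^-1 by rewrite invr_gt0; lra.
rewrite Dq mulrBl.
(* Over the common denominator [q + 1 + k], this reduces to [(q + 1) * (q - 1) <= q * q]. *)
have -> : g + (g - q') * (q - 1) = g * q - q' * (q - 1) by lra.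
rewrite lerD2l lerN2 /q' -mulrA [leRHS]mulrAC mulrCA [leRHS]mulrC ler_pM2l //.
lra.
Qed.

(** Each move of the player is eventually sampled, up to an error N / (N + k) that vanishes as k
    grows. *)
Lemma controlled_le_arrivals_prob m n c : (0 < d)%N ->
  controlled m n c <= arrivals_prob m c.
Proof.
move=> d0; elim: n c => [|n IHn] c.
  exact: le_trans (sampled_le_arrivals_prob m 0 c d0).
apply: controlled_ind => // x xc; apply/ler_addgt0Pr => e e0.
have [k ke] : exists k : nat, (size (awake c))%:R / (size (awake c) + k)%:R <= e.
  (* This [k] exceeds N / [e], so N / (N + [k]) is at most [e]. *)
  exists (Num.bound ((size (awake c))%:R / e)).
  have := archi_boundP (divr_ge0 (ler0n R (size (awake c))) (ltW e0)).
  rewrite ltr_pdivrMr // => /ltW Ne; have N0 : 0 < (size (awake c))%:R :> R.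
    by rewrite ltr0n; case: (awake c) xc.
  have k0 := ler0n R (Num.bound ((size (awake c))%:R / e)).
  rewrite natrD ler_pdivrMr; first by rewrite mulrC; nra.
  lra.
rewrite -lerBlDr; apply: le_trans (mean_move_le_arrivals_prob k d0 IHn xc).
by rewrite lerD2l lerN2.
Qed.

End Dynamics.
End Abelian.

(** * Comparison of two trees *)

(** An invariant of the reachable configurations; closure under parents makes [act] agree with the
    model on upward moves. *)
Definition valid d (c : config d) :=
  [/\ {in awake c, forall x, x.1 \in visited c}, [::] \in visited c &
      {in visited c, forall v, behead v \in visited c}].

Lemma valid_act d o x (c : config d) :
  valid c -> x.1 \in visited c -> valid (act o x c).
Proof.
move=> [v1 v2 v3] xc; case: o => [j|] /=; case: ifP => // _; split => //=.
- move=> y; rewrite !inE => /predU1P[->|/predU1P[->|/v1 ->]] /=;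
    by rewrite ?eqxx ?orbT.
- by move=> v; rewrite !inE => /predU1P[->/=|/v3 ->]; rewrite ?xc orbT.
- by move=> y; rewrite inE => /predU1P[-> /=|/v1//]; exact: v3.
Qed.

Definition fresh_pair d (v : site d) : seq (frog d) := [:: (v, true); (v, false)].

Definition map_frog d d' (phi : site d -> site d') (x : frog d) : frog d' :=
  (phi x.1, x.2).

(* c embeds in c' along phi when c' consists of a copy of c together with extra
   visited children of vertices of the copy, listed in E, whose pairs of frogs
   (the frog that arrived and the one it woke) have not moved yet. *)
Record embedding d d' (c : config d) (c' : config d')
    (phi : site d -> site d') (E : seq (site d')) : Prop := Embedding {
  emb_valid : valid c;
  emb_awake : perm_eq (awake c')
    (map (map_frog phi) (awake c) ++ flatten (map (@fresh_pair d') E));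
  emb_visited : visited c' =i map phi (visited c) ++ E;
  emb_arrivals : arrivals c = arrivals c';
  emb_inj : {in visited c &, injective phi};
  emb_parent : {in visited c, forall v, phi (behead v) = behead (phi v)};
  emb_root : {in visited c, forall v, (phi v == [::]) = (v == [::])};
  emb_uniq : uniq E;
  emb_disjoint : {in E, forall w, w \notin map phi (visited c)};
  emb_extra : {in E, forall w, behead w \in map phi (visited c)} }.

(** * Moves of embedded configurations *)

Lemma embedding_del_frog d d' (c : config d) (c' : config d') phi E x :
  embedding c c' phi E -> x \in awake c ->
  map_frog phi x \in awake c' /\
  embedding (del_frog x c) (del_frog (map_frog phi x) c') phi E.
Proof.
move=> e xc; have [[v1 v2 v3] a v ar i pa r u di ex] := e.
have xc' : map_frog phi x \in awake c'.
  by rewrite (perm_mem a) mem_cat map_f.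
split => //; split => //=.
  by split => // y /mem_rem; exact: v1.
rewrite -(perm_cons (map_frog phi x)).
rewrite (perm_trans _ (perm_trans a _)) //; first by rewrite perm_sym perm_to_rem.
rewrite -cat_cons -map_cons perm_cat2r; apply: perm_map; exact: perm_to_rem.
Qed.

Lemma embedding_up d d' (c : config d) (c' : config d') phi E x :
  embedding c c' phi E -> x.1 \in visited c ->
  embedding (act None x c) (act None (map_frog phi x) c') phi E.
Proof.
move=> [va a v ar i pa r u di ex] xc; have [_ _ v3] := va.
have := valid_act None va xc.
rewrite /= -pa // r ?v3 //; case: ifP => _ va'; split => //=.
- by rewrite ar.
- by rewrite perm_cons.
Qed.

(** The case where only the d'-ary process activates a child, which joins the unmoved extras. *)
Lemma embedding_extra d d' (c : config d) (c' : config d') phi E x j :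
  embedding c c' phi E -> x.1 \in visited c -> j :: phi x.1 \notin visited c' ->
  embedding c (act (Some j) (map_frog phi x) c') phi ((j :: phi x.1) :: E).
Proof.
move=> [va a v ar i pa r u di ex] xc jc; rewrite /= (negPf jc).
move: jc; rewrite v mem_cat negb_or => /andP[jc jE].
split => //=.
- rewrite perm_sym (perm_catCA _ (fresh_pair (j :: phi x.1))) /=.
  rewrite !perm_cons perm_sym; exact: a.
- by move=> w; rewrite inE v !mem_cat inE; rewrite orbCA.
- by rewrite jE.
- by move=> w; rewrite inE => /predU1P[->//|]; exact: di.
- by move=> w; rewrite inE => /predU1P[->/=|]; [exact: map_f|exact: ex].
Qed.

(** Common core of [embedding_new] and [embedding_old]. The child activated in [c] gets the image
    [w]: a child just activated in the d'-ary tree in the former, an extra one withdrawn from [E] in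
    the latter. *)
Lemma embedding_extend d d' (c : config d) (c' : config d') phi E x j
    (c'' : config d') w E' :
  embedding c c' phi E -> x.1 \in visited c -> j :: x.1 \notin visited c ->
  w != [::] -> behead w = phi x.1 -> w \notin map phi (visited c) -> w \notin E' ->
  {subset E' <= E} -> uniq E' ->
  perm_eq (awake c'') (fresh_pair w ++ map (map_frog phi) (awake c) ++
                       flatten (map (@fresh_pair d') E')) ->
  visited c'' =i w :: map phi (visited c) ++ E' ->
  arrivals c'' = arrivals c' ->
  embedding (act (Some j) x c) c''
    (fun u => if u == j :: x.1 then w else phi u) E'.
Proof.
move=> [va a v ar i pa r u di ex] xc jc w0 wx wc wE' sE uE' a'' v'' ar''.
have [v1 _ v3] := va; have := valid_act (Some j) va xc.
rewrite /= (negPf jc); set phi' := fun u => _; move=> va'.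
have phiE : {in visited c, phi' =1 phi}.
  by move=> y yc; rewrite /phi'; case: eqP => // e; rewrite -e yc in jc.
have phij : phi' (j :: x.1) = w by rewrite /phi' eqxx.
have mapE : map phi' (visited c) = map phi (visited c) by exact/eq_in_map.
have mem0 : {in visited c, forall y, phi y != w}.
  by move=> y yc; apply: contra wc => /eqP <-; exact: map_f.
split => //=.
- have -> : map (map_frog phi') (awake c) = map (map_frog phi) (awake c).
    by apply/eq_in_map => y /v1 yc; rewrite /map_frog phiE.
  by rewrite /map_frog /= phij.
- by move=> y; rewrite v'' phij mapE.
- by rewrite ar''.
- move=> y z; rewrite !inE => /predU1P[->|yc] /predU1P[->|zc] //;
    rewrite ?phij ?phiE //.
  + by move=> e; case/eqP: (mem0 z zc).
  + by move=> e; case/eqP: (mem0 y yc).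
  + exact: i.
- move=> y; rewrite inE => /predU1P[->|yc]; first by rewrite phij /= phiE.
  by rewrite !phiE ?v3 // pa.
- move=> y; rewrite inE => /predU1P[->|yc]; first by rewrite phij (negPf w0).
  by rewrite phiE // r.
- move=> y yE; rewrite phij mapE inE negb_or di ?sE // andbT.
  by apply: contra wE' => /eqP <-.
- by move=> y yE; rewrite phij mapE inE ex ?sE ?orbT.
Qed.

Lemma embedding_new d d' (c : config d) (c' : config d') phi E x j j' :
  embedding c c' phi E -> x.1 \in visited c -> j :: x.1 \notin visited c ->
  j' :: phi x.1 \notin visited c' ->
  exists phi',
    embedding (act (Some j) x c) (act (Some j') (map_frog phi x) c') phi' E.
Proof.
move=> e xc jc jc'; eexists.
have jc2 := jc'; move: jc2.
rewrite (emb_visited e) mem_cat negb_or => /andP[j1 j2].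
apply: (embedding_extend (w := j' :: phi x.1) e) => //=; rewrite ?(negPf jc') //=.
- exact: emb_uniq e.
- by rewrite !perm_cons (emb_awake e).
- by move=> y; rewrite !inE (emb_visited e).
Qed.

Lemma embedding_old d d' (c : config d) (c' : config d') phi E x j w :
  embedding c c' phi E -> x.1 \in visited c -> j :: x.1 \notin visited c ->
  w \in E -> behead w = phi x.1 ->
  exists phi', embedding (act (Some j) x c) c' phi' (rem w E).
Proof.
move=> e xc jc wE wx; eexists; have wc := emb_disjoint e wE.
apply: (embedding_extend (w := w) e) => //.
(* The root is not an extra vertex, being the image of the root. *)
- apply: contra wc => /eqP->; apply/mapP; exists [::]; first by have [[]] := e.
  by apply/esym/eqP; rewrite (emb_root e) //; have [[]] := e.
- by rewrite mem_rem_uniqF // (emb_uniq e).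
- by move=> y /mem_rem.
- by rewrite rem_uniq // (emb_uniq e).
- apply: (perm_trans (emb_awake e)); rewrite perm_sym perm_catCA perm_cat2l.
  rewrite -[_ ++ flatten _]/(flatten (map (@fresh_pair d') (w :: rem w E))).
  by apply/perm_flatten/perm_map; rewrite perm_sym perm_to_rem.
- move=> y; rewrite (emb_visited e) inE !mem_cat (perm_mem (perm_to_rem wE)) inE.
  by rewrite orbCA.
Qed.

(** In the main use [K] and [K'] are the labels of visited children and [l] is the value when
    nothing is activated. Let M be the maximum of [l] and all [a j]. The left mean is at most M -
    |K|/d (M - l). The right one is at least M - |K'|/d' (M - l), as off [K'] each [b j'] is at
    least M. Finally |K'|/d' <= |K|/d. *)
Lemma le_mean_ord (R : realType) d d' (a : 'I_d -> R) (b : 'I_d' -> R)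
    (K : {set 'I_d}) (K' : {set 'I_d'}) (l : R) :
  (0 < d <= d')%N -> (#|K'| <= #|K|)%N -> {in K, forall j, a j <= l} ->
  (forall j', l <= b j') -> (forall j' j, j' \notin K' -> a j <= b j') ->
  d%:R^-1 * \sum_j a j <= d'%:R^-1 * \sum_j b j.
Proof.
move=> /andP[d0 dd'] K'K aK bl ab.
set M := \big[Num.max/l]_j a j.
have lM : l <= M by exact: bigmax_ge_id.
have aM j : a j <= M by exact: le_bigmax.
have d0R : 0 < d%:R :> R by rewrite ltr0n.
have dd'R : d%:R <= d'%:R :> R by rewrite ler_nat.
have d'0R := lt_le_trans d0R dd'R.
have KR : #|K'|%:R <= #|K|%:R :> R by rewrite ler_nat.
have K'0 : 0 <= #|K'|%:R :> R by exact: ler0n.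
have sum_split n (f : 'I_n -> R) (A : {set 'I_n}) :
    \sum_j f j = \sum_(j in A) f j + \sum_(j in ~: A) f j.
  by rewrite (bigID (mem A)) /=; congr (_ + _); apply: eq_bigl => j; rewrite inE.
have cardC n (A : {set 'I_n}) : #|~: A|%:R = n%:R - #|A|%:R :> R.
  by apply/eqP; rewrite eq_sym subr_eq addrC -natrD cardsC card_ord.
have sa : \sum_j a j <= d%:R * M - #|K|%:R * (M - l).
  rewrite (sum_split _ _ K).
  apply: (@le_trans _ _ (\sum_(j in K) l + \sum_(j in ~: K) M)).
    by apply: lerD; apply: ler_sum.
  rewrite !sumr_const -[l *+ _]mulr_natr -[M *+ _]mulr_natr cardC; lra.
have sb : d'%:R * M - #|K'|%:R * (M - l) <= \sum_j b j.
  rewrite (sum_split _ _ K').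
  apply: (@le_trans _ _ (\sum_(j in K') l + \sum_(j in ~: K') M)).
    rewrite !sumr_const -[l *+ _]mulr_natr -[M *+ _]mulr_natr cardC; lra.
  apply: lerD; apply: ler_sum => // j jK'; apply: bigmax_le => // i _.
  by apply: ab; rewrite inE in jK'.
have d_neq0 := lt0r_neq0 d0R; have d'_neq0 := lt0r_neq0 d'0R.
apply: (@le_trans _ _ (M - #|K|%:R / d%:R * (M - l))).
  rewrite mulrC ler_pdivrMr // (le_trans sa) //.
  by rewrite le_eqVlt; apply/orP; left; apply/eqP; field.
apply: (@le_trans _ _ (M - #|K'|%:R / d'%:R * (M - l))).
  rewrite lerD2l lerN2 ler_wpM2r ?subr_ge0 // ler_pM ?invr_ge0 ?ler0n //.
  by rewrite lef_pV2.
rewrite [leRHS]mulrC ler_pdivlMr // (le_trans _ sb) //.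
by rewrite le_eqVlt; apply/orP; left; apply/eqP; field.
Qed.

Section Controlled.
Context (R : realType) (p : R) (p01 : 0 <= p <= 1) (d d' : nat)
  (dd' : (0 < d <= d')%N).

(* If the copy of x.1 has an extra visited child, every outcome of a downward
   move of x embeds in every outcome of the same move of the copy of x. Otherwise
   x.1 and its copy have equally many visited children. *)
Lemma embedding_mean_move m n (c : config d) (c' : config d') phi E x :
  (forall (c : config d) (c' : config d') phi E, embedding c c' phi E ->
     controlled p m n c <= controlled p m n c') ->
  embedding c c' phi E -> x.1 \in visited c ->
  mean_move p x (controlled p m n) c <=
  mean_move p (map_frog phi x) (controlled p m n) c'.
Proof.
move=> IHn e xc; have /andP[r0 r1] := frog_up_prob01 p01 x.
rewrite !mean_moveE; apply: lerD.
  by rewrite ler_wpM2l //; exact: (IHn _ _ _ _ (embedding_up e xc)).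
rewrite ler_wpM2l ?subr_ge0 //.
have [d0 _] := andP dd'.
have vE := emb_visited e.
have b_ge j' : controlled p m n c <=
    controlled p m n (act (Some j') (map_frog phi x) c').
  case: (boolP (j' :: phi x.1 \in visited c')) => j'c; last first.
    exact: (IHn _ _ _ _ (embedding_extra e xc j'c)).
  by rewrite /= j'c; exact: (IHn _ _ _ _ e).
case: (boolP (has (fun w => behead w == phi x.1) E)) => [|/hasPn noE].
  move=> /hasP[w wE /eqP wx].
  have ab j j' : controlled p m n (act (Some j) x c) <=
                 controlled p m n (act (Some j') (map_frog phi x) c').
    case: (boolP (j :: x.1 \in visited c)) => jc; first by rewrite [leLHS]/= jc.
    case: (boolP (j' :: phi x.1 \in visited c')) => j'c.
      have [phi' e'] := embedding_old e xc jc wE wx.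
      by rewrite [leRHS]/= j'c; exact: (IHn _ _ _ _ e').
    by have [phi' e'] := embedding_new e xc jc j'c; exact: (IHn _ _ _ _ e').
  (* By [ab] every [a j] is below every [b j'], so empty sets work, with any [a j] as [l]. *)
  apply: (le_mean_ord (K := finset.set0) (K' := finset.set0)
    (l := controlled p m n (act (Some (Ordinal d0)) x c))) => //.
  - by rewrite !cards0.
  - by move=> j; rewrite inE.
pose K : {set 'I_d} := [set j | j :: x.1 \in visited c].
pose K' : {set 'I_d'} := [set j | j :: phi x.1 \in visited c'].
apply: (le_mean_ord (K := K) (K' := K') (l := controlled p m n c)) => //.
- have [[_ v2 v3] _ _ _ inj par root _ _ _] := e.
  have d'0 : (0 < d')%N by case/andP: dd' => ?; exact: leq_trans.
  (* The label of the image of the child [j]. On [K] this image is not the root, so [head] does not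
     fall back on its default. As no extra vertex is a child of [phi x.1], the image of [K] under
     [f] covers [K']. *)
  pose f (j : 'I_d) := head (Ordinal d'0) (phi (j :: x.1)).
  apply: leq_trans (leq_imset_card f K); apply/subset_leq_card/fintype.subsetP => j'.
  rewrite inE vE mem_cat => /orP[/mapP[[|j t] uc uE]|/noE]; last by rewrite eqxx.
    by move/eqP: (root _ v2); rewrite -uE.
  have tc : t \in visited c := v3 _ uc.
  have tx : t = x.1 by apply: inj => //; rewrite (par _ uc) -uE.
  by apply/imsetP; exists j; rewrite /f ?inE -tx -?uE.
- by move=> j; rewrite inE /= => ->.
- move=> j' j; rewrite inE => j'c; case: (boolP (j :: x.1 \in visited c)) => jc.
    by rewrite [leLHS]/= jc.
  have [phi' e'] := embedding_new e xc jc j'c; exact: (IHn _ _ _ _ e').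
Qed.

Lemma embedding_controlled m n (c : config d) (c' : config d') phi E :
  embedding c c' phi E -> controlled p m n c <= controlled p m n c'.
Proof.
elim: n c c' phi E => [|n IHn] c c' phi E e; first by rewrite /= (emb_arrivals e).
apply: controlled_ind; first exact: le_trans (IHn _ _ _ _ e) (controlledS _ _ _ _).
move=> x xc; have [x'c e'] := embedding_del_frog e xc.
apply: le_trans (controlled_move _ _ _ x'c).
have xv : x.1 \in visited (del_frog x c).
  by have [[v _ _] _ _ _ _ _ _ _ _ _] := e; exact: v.
exact: embedding_mean_move IHn e' xv.
Qed.

(** Only the value of the map at the root, the sole visited vertex, matters. *)
Lemma embedding_initial :
  embedding (initial_config d) (initial_config d') (fun=> [::]) [::].
Proof.
split => //=; first by split => //= v; rewrite inE => /eqP->.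
- by move=> u v; rewrite !inE => /eqP-> /eqP->.
- by move=> v; rewrite inE => /eqP->.
Qed.

Lemma controlled_initial m n :
  controlled p m n (initial_config d) <= controlled p m n (initial_config d').
Proof. exact: embedding_controlled embedding_initial. Qed.

Lemma valid_initial : valid (initial_config d).
Proof. exact: emb_valid embedding_initial. Qed.

End Controlled.

(** * Finitely branching Markov chains *)

Local Open Scope classical_set_scope.
Local Open Scope ring_scope.

Section MarkovChain.
Context (R : realType) (T : countType).

(* A finitely branching transition kernel: succs c lists the weighted successors
   of c, possibly with repetitions. *)
Context (succs : T -> seq (R * T)).
Context (succs_ge0 : forall c s, s \in succs c -> 0 <= s.1).
Context (sum_succs : forall c, \sum_(s <- succs c) s.1 = 1).
Context (c0 : T).

Definition transition (c c' : T) : R := \sum_(s <- succs c) s.1 * (c' == s.2)%:R.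

Definition step_mean (F : T -> R) (c : T) : R := \sum_(s <- succs c) s.1 * F s.2.

Definition is_chain disp (W : measurableType disp) (P : probability W R)
    (X : nat -> W -> T) : Prop :=
  [/\ forall n c, measurable [set w | X n w = c],
      P [set w | X 0 w = c0] = 1%E &
      forall n (c : nat -> T),
        P [set w | forall k, (k <= n.+1)%N -> X k w = c k] =
        (P [set w | forall k, (k <= n)%N -> X k w = c k] *
         (transition (c n) (c n.+1))%:E)%E].

Lemma transition_ge0 c c' : 0 <= transition c c'.
Proof.
rewrite /transition big_seq sumr_ge0 // => s sc.
by rewrite mulr_ge0 ?ler0n ?(succs_ge0 sc).
Qed.

Lemma iter_step_mean_ge0 n F c : (forall c', 0 <= F c') -> 0 <= iter n step_mean F c.
Proof.
move=> F0; elim: n c => [//|n IHn] c /=.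
rewrite /step_mean big_seq sumr_ge0 // => s sc.
by rewrite mulr_ge0 ?(succs_ge0 sc).
Qed.

Lemma iter_step_meanB n F G c :
  iter n step_mean (fun c' => F c' - G c') c =
  iter n step_mean F c - iter n step_mean G c.
Proof.
elim: n c => [//|n IHn] c /=; rewrite /step_mean -sumrB.
by apply: eq_bigr => s _; rewrite IHn mulrBr.
Qed.

Lemma iter_step_mean1 n c : iter n step_mean (fun=> 1) c = 1.
Proof.
elim: n c => [//|n IHn] c /=; rewrite /step_mean.
by under eq_bigr do rewrite IHn mulr1.
Qed.

(** [undup] merges repeated successors, whose weights [transition] adds up. *)
Lemma step_mean_transition F c :
  step_mean F c = \sum_(c' <- undup (map snd (succs c))) transition c c' * F c'.
Proof.
rewrite /transition; under eq_bigr do rewrite mulr_suml.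
rewrite exchange_big /= /step_mean big_seq [RHS]big_seq; apply: eq_bigr => s sc.
rewrite (bigD1_seq s.2) ?undup_uniq ?mem_undup ?map_f //= eqxx mulr1 big1 ?addr0 //.
by move=> c' /negPf ->; rewrite mulr0 mul0r.
Qed.

(** * Law of a chain at a fixed time *)

Section Law.
Context disp (W : measurableType disp) (P : probability W R) (X : nat -> W -> T).
Context (chainX : is_chain P X).

Lemma measurable_chain n (B : pred T) : measurable [set w | B (X n w)].
Proof.
have -> : [set w | B (X n w)] =
    \bigcup_(c : T) (if B c then [set w | X n w = c] else set0).
  apply/seteqP; split => [w /= Bw|w [c _]].
    by exists (X n w) => //; rewrite Bw.
  by case: ifP => //= Bc ->.
apply: countable_bigcupT_measurable => [|c]; first exact: countableP.
by case: ifP => // _; case: chainX.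
Qed.

Lemma measurable_path n (c : nat -> T) :
  measurable [set w | forall k, (k <= n)%N -> X k w = c k].
Proof.
have -> : [set w | forall k, (k <= n)%N -> X k w = c k] =
    \bigcap_(k in [set k | (k <= n)%N]) [set w | X k w = c k].
  by apply/seteqP; split => w /= h k; exact: h.
by apply: bigcap_measurable => [|k _]; [exists 0%N|case: chainX].
Qed.

Lemma le_measure_subset (A B : set W) :
  measurable A -> measurable B -> A `<=` B -> (P A <= P B)%E.
Proof. by move=> mA mB; apply: le_measure; rewrite inE. Qed.

Lemma sum_measure_preimage_le (Y : W -> T) (D : set W) (L : seq T) :
  (forall c, measurable [set w | Y w = c]) -> measurable D -> uniq L ->
  (\sum_(c <- L) P (D `&` [set w | Y w = c]) <= P D)%E.
Proof.
move=> mY; elim: L D => [|c L IHL] D mD; first by rewrite big_nil.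
rewrite /= big_cons => /andP[cL uL].
have mc := mY c.
have DE : P D = (P (D `&` [set w | Y w = c]) + P (D `\` [set w | Y w = c]))%E.
  rewrite addeC -measureDI //.
rewrite DE leeD2l //; apply: le_trans (IHL _ (measurableD mD mc) uL).
rewrite big_seq [leRHS]big_seq; apply: lee_sum => c' c'L.
apply: le_measure_subset; first exact: measurableI.
  by apply: measurableI => //; exact: measurableD.
move=> w [Dw Yw]; split => //; split => // Yc; move: cL.
by rewrite -Yc Yw c'L.
Qed.

(** Each successor of [c k] extends the path by one step, and distinct successors give disjoint
    events. Summing over this finite list yields a lower bound, which [chain_law] makes an
    equality. *)
Lemma chain_law_ge k n (c : nat -> T) (B : pred T) :
  (P [set w | forall j, (j <= k)%N -> X j w = c j] *
    (iter n step_mean (fun c => (B c)%:R) (c k))%:E <=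
  P ([set w | forall j, (j <= k)%N -> X j w = c j] `&`
     [set w | B (X (k + n)%N w)]))%E.
Proof.
elim: n k c => [|n IHn] k c.
  rewrite addn0 /=; case: (boolP (B (c k))) => Bc; last by rewrite mule0.
  rewrite mule1 le_measure_subset //; first exact: measurable_path.
    by apply: measurableI; [exact: measurable_path|exact: measurable_chain].
  by move=> w /= h; split => //; rewrite h.
set A := [set w | _]; set D := A `&` _.
have mD : measurable D.
  by apply: measurableI; [exact: measurable_path|exact: measurable_chain].
have mX c' : measurable [set w | X k.+1 w = c'] by case: chainX.
apply: le_trans (sum_measure_preimage_le
  (L := undup (map snd (succs (c k)))) mX mD (undup_uniq _)).
rewrite /= step_mean_transition -sumEFin ge0_sume_distrr; last first.
  by move=> c' _; rewrite lee_fin mulr_ge0 ?transition_ge0 ?iter_step_mean_ge0.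
apply: lee_sum => c' _.
pose path j := if j == k.+1 then c' else c j.
have pathS : path k.+1 = c' by rewrite /path eqxx.
have pathE j : (j <= k)%N -> path j = c j by move=> jk; rewrite /path ltn_eqF.
have [_ _ /(_ k path) Pk] := chainX.
rewrite pathS pathE // in Pk.
have -> : D `&` [set w | X k.+1 w = c'] =
   [set w | forall j, (j <= k.+1)%N -> X j w = path j] `&`
   [set w | B (X (k.+1 + n)%N w)].
  rewrite addSnnS; apply/seteqP; split => w /=.
    move=> [[Aw Bw] Xw]; split => // j; rewrite leq_eqVlt => /predU1P[->|jk].
      by rewrite pathS.
    by rewrite pathE // Aw.
  move=> [h Bw]; split; last by rewrite h // pathS.
  by split => // j jk; rewrite h ?(leqW jk) // pathE.
have := IHn k.+1 path; rewrite Pk pathS; apply: le_trans.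
rewrite EFinM muleA.
have -> // : [set w | forall j, (j <= k)%N -> X j w = path j] = A.
by apply/seteqP; split => w /= h j jk; rewrite h // pathE.
Qed.

Lemma chain_law_initial_ge n (B : pred T) :
  ((iter n step_mean (fun c => (B c)%:R) c0)%:E <= P [set w | B (X n w)])%E.
Proof.
have [mX X0 _] := chainX; have := chain_law_ge 0 n (fun=> c0) B.
have -> : [set w | forall j, (j <= 0)%N -> X j w = c0] = [set w | X 0 w = c0].
  by apply/seteqP; split => w /= h; [exact: h|move=> j; rewrite leqn0 => /eqP->].
rewrite X0 mul1e add0n => /le_trans; apply.
apply: le_measure_subset; last by move=> w [].
  by apply: measurableI; [exact: mX|exact: measurable_chain].
exact: measurable_chain.
Qed.

(** The lower bounds for [B] and its complement add up to 1, so neither is strict. *)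
Lemma chain_law n (B : pred T) :
  P [set w | B (X n w)] = (iter n step_mean (fun c => (B c)%:R) c0)%:E.
Proof.
apply/eqP; rewrite eq_le chain_law_initial_ge andbT.
have := chain_law_initial_ge n (predC B).
have -> : [set w | predC B (X n w)] = ~` [set w | B (X n w)].
  by apply/seteqP; split => w /=; [move/negP|move/negP].
have -> : (fun c => (predC B c)%:R) = (fun c => 1 - (B c)%:R) :> (T -> R).
  by apply/funext => c /=; case: (B c); rewrite /= ?subrr ?subr0.
rewrite iter_step_meanB iter_step_mean1 probability_setC; last first.
  exact: measurable_chain.
rewrite -(fineK (fin_num_measure P _ (measurable_chain n B))).
by rewrite -EFinB !lee_fin; lra.
Qed.

End Law.

(** * A realization on the unit interval *)

Section Realization.

(* The sample space is the unit interval: a state (c, a, l) stands for a history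
   of the chain that ends at c and is followed by the points of [a, a + l[. The
   next step cuts this interval into consecutive ones, with lengths proportional
   to the weights of succs c. *)
Let state := (T * R * R)%type.
Local Notation mu := (@lebesgue_measure R).

(** Testing right ends suffices, as a point failing a test lies beyond that interval. The default
    [s0] is for points beyond all intervals; if the weights sum to 1, no point of [a, a + l[ reaches
    it. *)
Fixpoint pick_interval (L : seq (R * T)) (s0 : state) (u a l : R) : state :=
  if L is s :: L' then
    if u < a + l * s.1 then (s.2, a, l * s.1)
    else pick_interval L' s0 u (a + l * s.1) l
  else s0.

Definition next_interval (u : R) (s : state) : state :=
  pick_interval (succs s.1.1) s u s.1.2 s.2.

Lemma measurable_cst_prop (A : Prop) : measurable [set u : R | A].
Proof.
have [a|na] := pselect A.
  by have -> : [set u : R | A] = setT by apply/seteqP; split.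
by have -> : [set u : R | A] = set0 by apply/seteqP; split.
Qed.

Lemma measurable_lt (b : R) : measurable [set u : R | u < b].
Proof. by rewrite -set_itvNyo; exact: measurable_itv. Qed.

(** The set [Q s] can depend on the point [u] because the same [u] drives all steps. *)
Lemma measurable_pick_interval (Q : state -> set R) L s0 a l :
  (forall s, measurable (Q s)) ->
  measurable [set u : R | Q (pick_interval L s0 u a l) u].
Proof.
move=> mQ; elim: L a => [|s L IHL] a /=; first exact: mQ.
have -> : [set u : R | Q (if u < a + l * s.1 then (s.2, a, l * s.1)
      else pick_interval L s0 u (a + l * s.1) l) u] =
    [set u : R | u < a + l * s.1] `&` Q (s.2, a, l * s.1) `|`
    ~` [set u : R | u < a + l * s.1] `&`
      [set u : R | Q (pick_interval L s0 u (a + l * s.1) l) u].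
  apply/seteqP; split => u /=; case: ifP => ua.
  - by left.
  - by right.
  - by case=> [[]|[]].
  - by case=> [[]|[]].
have mb := measurable_lt (a + l * s.1).
apply: measurableU; first exact: measurableI.
by apply: measurableI; [exact: measurableC|exact: IHL].
Qed.

Lemma measurable_next_interval (Q : state -> set R) n s :
  (forall s, measurable (Q s)) ->
  measurable [set u : R | Q (iter n (next_interval u) s) u].
Proof.
elim: n Q => [|n IHn] Q mQ; first exact: mQ.
apply: (IHn (fun s => [set u : R | Q (next_interval u s) u])) => s'.
exact: measurable_pick_interval.
Qed.

(** The intervals of the successors are disjoint and consecutive, so measures add up; [g s.2] is the
    proportion of the interval of [s] that lies in [Q]. *)
Lemma measure_pick_interval (Q : state -> set R) (g : T -> R) L s0 a l :
  0 <= l -> (forall s, measurable (Q s)) -> (forall s, s \in L -> 0 <= s.1) ->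
  (forall s b, s \in L ->
     mu (`[b, b + l * s.1[ `&` Q (s.2, b, l * s.1)) = (l * s.1 * g s.2)%:E) ->
  mu (`[a, a + l * \sum_(s <- L) s.1[ `&`
      [set u : R | Q (pick_interval L s0 u a l) u]) =
  (l * \sum_(s <- L) s.1 * g s.2)%:E.
Proof.
move=> l0 mQ; elim: L a => [|s L IHL] a L0 muQ.
  by rewrite !big_nil mulr0 addr0 set_itvco0 set0I measure0.
have s0' : 0 <= l * s.1 by rewrite mulr_ge0 // L0 ?mem_head.
have L0' s' : s' \in L -> 0 <= s'.1 by move=> s'L; rewrite L0 // inE s'L orbT.
have sL0 : 0 <= l * \sum_(s <- L) s.1.
  by rewrite mulr_ge0 // big_seq sumr_ge0 // => s'; exact: L0'.
rewrite !big_cons /= !mulrDr EFinD mulrA -(muQ s a) ?mem_head //.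
rewrite -(IHL (a + l * s.1)) //; last first.
  by move=> s' b s'L; apply: muQ; rewrite inE s'L orbT.
rewrite -measureU; last first.
- apply/seteqP; split => // u /= [[+ _] [+ _]]; rewrite !in_itv /=; lra.
- apply: measurableI; [exact: measurable_itv|exact: measurable_pick_interval].
- apply: measurableI; [exact: measurable_itv|exact: mQ].
congr (mu _); apply/seteqP; split => u /=; rewrite !in_itv /=.
  move=> [/andP[au ub]]; case: ifPn => us Qu; first by left; rewrite au.
  by right; split => //; rewrite leNgt us -addrA.
move=> [[/andP[au us] Qu]|[/andP[su us] Qu]].
  by rewrite us; split => //; rewrite au /=; lra.
have -> : (u < a + l * s.1) = false by rewrite ltNge su.
split => //; apply/andP; split; lra.
Qed.

Lemma measurable_itv_path n (path : nat -> T) s :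
  measurable [set u : R | forall k, (k <= n)%N ->
                 (iter k (next_interval u) s).1.1 = path k].
Proof.
have -> : [set u : R | forall k, (k <= n)%N ->
                 (iter k (next_interval u) s).1.1 = path k] =
    \bigcap_(k in [set k | (k <= n)%N])
       [set u : R | (iter k (next_interval u) s).1.1 = path k].
  by apply/seteqP; split => u /= h k; exact: h.
apply: bigcap_measurable => [|k _]; first by exists 0%N.
apply: (measurable_next_interval (Q := fun s => [set u | s.1.1 = path k])) => s'.
exact: measurable_cst_prop.
Qed.

Lemma measure_itv_path n (path : nat -> T) c a l : 0 <= l ->
  mu (`[a, a + l[ `&` [set u : R | forall k, (k <= n)%N ->
         (iter k (next_interval u) (c, a, l)).1.1 = path k]) =
  (l * ((c == path 0%N)%:R * \prod_(k < n) transition (path k) (path k.+1)))%:E.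
Proof.
elim: n path c a l => [|n IHn] path c a l l0.
  have [cp|/eqP cp] := eqVneq c (path 0%N); last first.
    have -> : [set u : R | forall k, (k <= 0)%N ->
         (iter k (next_interval u) (c, a, l)).1.1 = path k] = set0.
      by apply/seteqP; split => // u /= /(_ 0%N isT).
    by rewrite setI0 measure0 mul0r mulr0.
  have -> : [set u : R | forall k, (k <= 0)%N ->
         (iter k (next_interval u) (c, a, l)).1.1 = path k] = setT.
    by apply/seteqP; split => // u _ k /=; rewrite leqn0 => /eqP->.
  rewrite big_ord0 !mulr1 setIT lebesgue_measure_itv /= lte_fin; case: ifPn => [_|].
    by rewrite -EFinB addrAC subrr add0r.
  by rewrite ltrDl -leNgt => l0'; congr EFin; apply/eqP; rewrite eq_le l0 l0'.
have [cp|/eqP cp] := eqVneq c (path 0%N); last first.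
  have -> : [set u : R | forall k, (k <= n.+1)%N ->
       (iter k (next_interval u) (c, a, l)).1.1 = path k] = set0.
    by apply/seteqP; split => // u /= /(_ 0%N isT).
  by rewrite setI0 measure0 mul0r mulr0.
rewrite mul1r big_ord_recl /= /bump /=.
pose Q s := [set u : R | forall k, (k <= n)%N ->
  (iter k (next_interval u) s).1.1 = path k.+1].
have mQ s : measurable (Q s) by exact: measurable_itv_path.
(* The probability that the chain started at [c'] follows [path] shifted by one. *)
pose g c' : R :=
  (c' == path 1%N)%:R * \prod_(k < n) transition (path k.+1) (path k.+2).
have := @measure_pick_interval Q g (succs c) (c, a, l) a l l0 mQ
  (succs_ge0 (c := c)).
rewrite sum_succs mulr1 => muE.
have -> : [set u : R | forall k, (k <= n.+1)%N ->
             (iter k (next_interval u) (c, a, l)).1.1 = path k] =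
    [set u | Q (pick_interval (succs c) (c, a, l) u a l) u].
  apply/seteqP; split => u /= h.
    by move=> k kn; rewrite -(h k.+1) // iterSr.
  case=> [//|k kn]; rewrite iterSr; exact: h.
rewrite muE; last by move=> s b sc; rewrite IHn // mulr_ge0 // (succs_ge0 sc).
congr (_ * _)%:E; rewrite /g -cp /transition mulr_suml; apply: eq_bigr => s _.
by rewrite mulrA eq_sym.
Qed.

Definition unit_itv_measure := mrestr mu (measurable_itv `[(0 : R), 1[).

HB.instance Definition _ := Measure.on unit_itv_measure.

Lemma unit_itv_measureT : unit_itv_measure setT = 1%E.
Proof.
rewrite /unit_itv_measure /mrestr setTI lebesgue_measure_itv /= lte_fin ltr01.
exact: sube0.
Qed.

HB.instance Definition _ :=
  Measure_isProbability.Build _ _ _ unit_itv_measure unit_itv_measureT.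

Definition interval_chain (n : nat) (u : R) : T :=
  (iter n (next_interval u) (c0, 0, 1)).1.1.

(** Since [recurrent] quantifies over all realizations, one must exist before anything can be
    deduced from it. *)
Lemma realization :
  is_chain unit_itv_measure interval_chain.
Proof.
have pathE n path : unit_itv_measure [set u : R | forall k, (k <= n)%N ->
      (iter k (next_interval u) (c0, 0, 1)).1.1 = path k] =
    ((c0 == path 0%N)%:R * \prod_(k < n) transition (path k) (path k.+1))%:E.
  rewrite -[RHS]/(_%:E) -[X in X%:E]mul1r -(measure_itv_path _ _ _ 0) //.
  by rewrite add0r setIC.
split => [n c||n c] /=.
- apply: (measurable_next_interval (Q := fun s => [set u | s.1.1 = c])) => s.
  by apply: measurable_cst_prop.
- rewrite (_ : [set w | c0 = c0] = setT) ?unit_itv_measureT //.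
  by apply/seteqP; split.
- by rewrite !pathE big_ord_recr /= mulrA EFinM.
Qed.

(** This covers every real [u], also outside [0, 1[, and makes arrivals monotone in time at every
    sample point. *)
Lemma interval_chainS n u : interval_chain n.+1 u = interval_chain n u \/
  exists2 s, s \in succs (interval_chain n u) & interval_chain n.+1 u = s.2.
Proof.
rewrite /interval_chain iterS; case: (iter _ _ _) => [[c a] l].
(* Only the left end of the interval is generalized, not the [a] inside the default state. *)
rewrite /next_interval /=; elim: (succs c) {2 4}a => [|s L IHL] b /=; first by left.
case: ifP => _; first by right; exists s; rewrite ?mem_head.
case: (IHL (b + l * s.1)) => [->|[s' s'L ->]]; first by left.
by right; exists s'; rewrite // inE s'L orbT.
Qed.

End Realization.
End MarkovChain.

(** * The recursive frog model as a Markov chain *)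

Section Model.
Context (R : realType) (p : R) (p01 : 0 <= p <= 1).

Section Fixed_d.
Context (d : nat) (d0 : (0 < d)%N).
Implicit Types (c : config d).

Definition outcome c (i : nat) (o : option 'I_d) : config d :=
  if o is Some j then move_down c i j else move_up c i.

Definition successors c : seq (R * config d) :=
  let n := size (awake c) in
  if n == 0%N then [:: (1, c)]
  else [seq (n%:R^-1 * weight p (awake_frog c i) o, outcome c i o)
         | i : 'I_n <- enum 'I_n, o <- enum {: option 'I_d}].

Lemma sum_successors c (F : config d -> R) :
  \sum_(s <- successors c) s.1 * F s.2 =
  if size (awake c) == 0%N then F c
  else (size (awake c))%:R^-1 *
    \sum_(i < size (awake c)) \sum_o weight p (awake_frog c i) o * F (outcome c i o).
Proof.
rewrite /successors; case: ifP => _; first by rewrite big_seq1 mul1r.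
rewrite big_allpairs_dep big_enum /= mulr_sumr; apply: eq_bigr => i _.
rewrite big_enum /= mulr_sumr; apply: eq_bigr => o _.
by rewrite mulrA.
Qed.

Lemma successors_ge0 c s : s \in successors c -> 0 <= s.1.
Proof.
rewrite /successors; case: ifP => _; first by rewrite inE => /eqP -> /=.
case/allpairsP => -[i o] /= [_ _ ->] /=.
by rewrite mulr_ge0 ?invr_ge0 ?ler0n ?weight_ge0.
Qed.

Lemma sum_successors1 c : \sum_(s <- successors c) s.1 = 1.
Proof.
have := sum_successors c (fun=> 1); under eq_bigr do rewrite mulr1.
move=> ->; case: eqP => [//|/eqP n0].
under eq_bigr do under eq_bigr do rewrite mulr1.
under eq_bigr do rewrite (sum_weight p _ d0).
by rewrite sumr_const card_ord mulVf // pnatr_eq0.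
Qed.

Lemma step_probE c c' : step_prob p c c' = transition successors c c'.
Proof.
rewrite /transition (sum_successors c (fun c'' => (c' == c'')%:R)) /step_prob.
case: ifP => // _; rewrite mulr_sumr; apply: eq_bigr => i _.
by rewrite big_option.
Qed.

Lemma perm_replace_frog c i s : (i < size (awake c))%N ->
  perm_eq (replace_frog c i s) (s ++ rem (awake_frog c i) (awake c)).
Proof.
move=> ic; have xc : awake_frog c i \in awake c by exact: mem_nth.
rewrite /replace_frog perm_catCA perm_cat2l -(perm_cons (awake_frog c i)).
rewrite -[X in perm_eq X _]/([:: _] ++ _ ++ _) perm_catCA /=.
by rewrite -drop_nth // cat_take_drop perm_to_rem.
Qed.

(** Validity says that the parent is already visited, so an upward move wakes no frog. Replacing by
    index and deleting by value differ only in the order of the frogs. *)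
Lemma outcome_equiv c i o : valid c -> (i < size (awake c))%N ->
  let x := awake_frog c i in
  config_equiv (outcome c i o) (act o x (del_frog x c)).
Proof.
move=> [v1 v2 v3] ic x; have xc : x.1 \in visited c by apply: v1; exact: mem_nth.
have bxc := v3 _ xc.
case: o => [j|] /=; rewrite /move_down /move_up -/x.
  by case: ifP => jc; split => //=; rewrite /woken /visit ?jc //;
    exact: perm_replace_frog.
by case: ifP => _; split => //=; rewrite /woken /visit ?bxc //;
  exact: perm_replace_frog.
Qed.

Lemma valid_equiv c c' : config_equiv c c' -> valid c -> valid c'.
Proof.
move=> [a v _] [v1 v2 v3]; split.
    by move=> x; rewrite -(perm_mem a) -v; exact: v1.
  by rewrite -v.
by move=> w; rewrite -!v; exact: v3.
Qed.

Lemma valid_outcome c i o : valid c -> (i < size (awake c))%N ->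
  valid (outcome c i o).
Proof.
move=> vc ic; apply: valid_equiv (config_equiv_sym (outcome_equiv o vc ic)) _.
have [v1 v2 v3] := vc; apply: valid_act; last by apply: v1; exact: mem_nth.
by split => // y /mem_rem; exact: v1.
Qed.

Lemma iter_step_mean_sampled m n c : valid c ->
  iter n (step_mean successors) (fun c => (m <= arrivals c)%N%:R) c =
  sampled p m n c.
Proof.
elim: n c => [//|n IHn] c vc; rewrite sampledS iterS /step_mean sum_successors.
rewrite /uniform_move; case: eqP => [_|_]; first exact: IHn.
congr (_ * _); rewrite (big_nth (initial_frog d)) big_mkord; apply: eq_bigr => i _.
apply: eq_bigr => o _; rewrite IHn; last exact: valid_outcome.
by rewrite (sampled_equiv _ _ _ (outcome_equiv o vc (ltn_ord i))).
Qed.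

Lemma arrivals_outcome c i o : (arrivals c <= arrivals (outcome c i o))%N.
Proof. by case: o => [j|]; rewrite /= /move_down /move_up; case: ifP => //=. Qed.

(** * Recurrence and arrival probabilities *)

Lemma RFM_chain disp (W : measurableType disp) (P : probability W R)
    (X : nat -> W -> config d) :
  is_RFM p P X <-> is_chain successors (initial_config d) P X.
Proof.
by split => -[mX X0 PX]; split => // n c; rewrite PX step_probE.
Qed.

Lemma RFM_arrivals disp (W : measurableType disp) (P : probability W R)
    (X : nat -> W -> config d) m n :
  is_RFM p P X ->
  P [set w | (m <= arrivals (X n w))%N] = (sampled p m n (initial_config d))%:E.
Proof.
move=> /RFM_chain XP.
rewrite (chain_law successors_ge0 sum_successors1 XP n
  (fun c => (m <= arrivals c)%N)).
rewrite iter_step_mean_sampled //; exact: (@valid_initial d d).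
Qed.

Lemma measurable_arrivals disp (W : measurableType disp) (P : probability W R)
    (X : nat -> W -> config d) m n :
  is_RFM p P X -> measurable [set w | (m <= arrivals (X n w))%N].
Proof.
move=> /RFM_chain XP.
exact: (measurable_chain XP n (fun c => (m <= arrivals c)%N)).
Qed.

(** Continuity of [P] from below; the events increase because arrivals are monotone at every sample
    point. *)
Lemma RFM_arrivals_prob disp (W : measurableType disp) (P : probability W R)
    (X : nat -> W -> config d) m :
  is_RFM p P X -> (forall n w, (arrivals (X n w) <= arrivals (X n.+1 w))%N) ->
  {ae P, forall w, exists n, (m <= arrivals (X n w))%N} ->
  arrivals_prob p m (initial_config d) = 1.
Proof.
move=> XP ndX ae_m; pose F n := [set w | (m <= arrivals (X n w))%N].
have mF n : measurable (F n) by exact: measurable_arrivals XP.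
have mU : measurable (\bigcup_n F n) by exact: bigcup_measurable.
have ndF : {homo F : n k / (n <= k)%N >-> (n <= k)%O}.
  apply/nondecreasing_seqP => n; apply/subsetPset => w; rewrite /F /= => /leq_trans.
  exact.
have PU : P (\bigcup_n F n) = 1%E.
  rewrite -[\bigcup_n F n]setCK (probability_setC _ (measurableC mU)).
  rewrite (_ : P (~` _) = 0%E) ?sube0 //.
  apply/negligibleP; first exact: measurableC.
  by apply: negligibleS ae_m => w /= nU [n mn]; apply: nU; exists n.
have : limn (P \o F) = 1%E.
  by rewrite -PU; apply/cvg_lim => //; exact: nondecreasing_cvg_mu.
rewrite (_ : _ \o F =
  EFin \o (fun n => sampled p m n (initial_config d))); last first.
  by apply/funext => n /=; rewrite -(RFM_arrivals m n XP).
rewrite EFin_lim; last exact: sampled_is_cvg.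
by case.
Qed.

Lemma recurrent_arrivals_prob m : recurrent d p ->
  arrivals_prob p m (initial_config d) = 1.
Proof.
pose X := interval_chain successors (initial_config d).
have XP : is_RFM p (@unit_itv_measure R) X.
  exact/RFM_chain/(realization successors_ge0 sum_successors1).
move=> /(_ _ _ _ _ XP) rec; apply: (RFM_arrivals_prob XP) => [n u|].
  have : X n.+1 u = X n u \/ exists2 s, s \in successors (X n u) & X n.+1 u = s.2.
    exact: interval_chainS.
  case=> [->//|[s sX ->]].
  move: sX; rewrite /successors; case: ifP => _; first by rewrite inE => /eqP->.
  by case/allpairsP => -[i o] /= [_ _ ->]; exact: arrivals_outcome.
by apply: filterS rec => u; exact.
Qed.

(** For fixed [m], the event of ever reaching [m] arrivals contains the events at all times, whose
    probabilities tend to 1; then intersect over [m]. *)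
Lemma arrivals_prob_recurrent :
  (forall m, arrivals_prob p m (initial_config d) = 1) -> recurrent d p.
Proof.
move=> ev disp W P X XP; apply: ae_foralln => m.
have mXm n : measurable [set w | (m <= arrivals (X n w))%N].
  exact: measurable_arrivals XP.
pose U := \bigcup_n [set w | (m <= arrivals (X n w))%N].
have mU : measurable U by exact: bigcup_measurable.
have PU : P U = 1%E.
  apply/eqP; rewrite eq_le probability_le1 //=.
  rewrite -(fineK (fin_num_measure P _ mU)) lee_fin.
  rewrite -(ev m); apply: limr_le; first exact: sampled_is_cvg.
  apply: nearW => n; rewrite -lee_fin fineK ?fin_num_measure //.
  rewrite -(RFM_arrivals m n XP).
  by apply: le_measure; rewrite ?inE //; exact: (bigcup_sup (i := n)).
have PC : P (~` U) = 0%E by rewrite probability_setC // PU subee.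
exists (~` U); split => //; first exact: measurableC.
by move=> w /= nw Uw; apply: nw; case: Uw => n _ /= h; exists n.
Qed.

End Fixed_d.

Lemma recurrent_mono d d' : (0 < d <= d')%N -> recurrent d p -> recurrent d' p.
Proof.
move=> dd'; have [d0 led] := andP dd'; have d'0 := leq_trans d0 led.
move=> rec; apply: (arrivals_prob_recurrent d'0) => m.
apply/eqP; rewrite eq_le; apply/andP; split.
  apply: limr_le; first exact: sampled_is_cvg.
  by apply: nearW => n; exact: sampled_le1.
rewrite -(recurrent_arrivals_prob d0 m rec).
apply: limr_le; first exact: sampled_is_cvg.
apply: nearW => n.
(* Uniform sampling on the d-ary tree, its optimum, the optimum on the d'-ary tree and the sampling
   limit there are successively larger. *)
apply: le_trans (sampled_le_controlled _ _ _ _ d0) _ => //.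
apply: le_trans (controlled_initial p01 dd' m n) _.
exact: controlled_le_arrivals_prob.
Qed.
End Model.

Theorem proposition3 (R : realType) (d : nat) (hd : (2 <= d)%N) :
  (critical_drift R d.+1 <= critical_drift R d)%E.
Proof.
apply: ereal_inf_le_tmp => _ [p [p01 rec] <-]; exists p => //; split => //.
by apply: (recurrent_mono p01) rec; rewrite leqnSn andbT; exact: ltnW.
Qed.
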